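(* Let $n\ge 2$ be an integer, and let $p\in[0,1)$ and $q\in(0,1]$ with $(p,q)\ne(0,1)$. In a round of Knockout with $n$ players, each having probability $p$ of making a long shot and probability $q$ of making a short shot, the expected number of steps before someone is eliminated (that is, the expected number of transitions until absorption of the round's Markov chain started in the state $(1,1)$) equals $$\frac{-\left(p+q-3\right)\left(p^{2}-pq-2p+2q+1\right)}{q\left(p-3\right)\left(p-1\right)\left(p-q+1\right)}.$$
   Context: A round of Knockout with $n$ equally skilled players $P_1,\dots,P_n$ (indices modulo $n$, $P_{k+1}$ directly behind $P_k$) is modelled as an absorbing Markov chain. Long shots (LS) are made with probability $p$ and short shots (SS) with probability $q$, independently. The transient states are pairs $(b,k)$ with $b\in\{1,2,3,4,5\}$ and $k\in\mathbb{Z}/n$, meaning: $(1,k)$: $P_k$ takes LS, then $P_{k+1}$ takes LS. $(2,k)$: $P_k$ takes SS, then $P_{k+1}$ takes SS. $(3,k)$: $P_{k+1}$ takes SS, then $P_k$ takes SS. $(4,k)$: $P_k$ takes SS, then $P_{k+1}$ takes LS. $(5,k)$: $P_{k+1}$ takes LS, then $P_k$ takes SS. In each of these states $P_k$ is the player in danger of being eliminated by $P_{k+1}$. The absorbing states are $E_k$, $k\in\mathbb{Z}/n$: ''$P_k$ is eliminated''. The round starts in $(1,1)$. The transition probabilities (all others being $0$) are: From $(1,k)$: to $(1,k+2)$ with $p^2$, to $(2,k)$ with $(1-p)^2$, to $(5,k+1)$ with $p(1-p)$, to $E_k$ with $(1-p)p$. From $(2,k)$: to $(1,k+2)$ with $q^2$,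 to $(2,k)$ with $(1-q)^2$, to $(5,k+1)$ with $q(1-q)$, to $E_k$ with $(1-q)q$. From $(3,k)$: to $(3,k)$ with $(1-q)^2$, to $(4,k+1)$ with $(1-q)q$, to $E_k$ with $q$. From $(4,k)$: to $(1,k+2)$ with $qp$, to $(2,k)$ with $(1-q)(1-p)$, to $(5,k+1)$ with $q(1-p)$, to $E_k$ with $(1-q)p$. From $(5,k)$: to $(3,k)$ with $(1-p)(1-q)$, to $(4,k+1)$ with $(1-p)q$, to $E_k$ with $p$. Each $E_k$ stays put with probability $1$. For $n=2$ the states reachable from $(1,1)$ are only $(1,1),(2,1),(4,1),(5,2),(3,2)$ and $E_1,E_2$. A step is one transition of this chain. *)

(* Defs.v *)
From HB Require Import structures.
From mathcomp Require Import all_boot all_order all_algebra.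
From mathcomp Require Import all_classical all_reals all_analysis.

Set Implicit Arguments.
Unset Strict Implicit.
Unset Printing Implicit Defensive.

Import Order.TTheory GRing.Theory Num.Theory.
Import numFieldNormedType.Exports.

Local Open Scope classical_set_scope.
Local Open Scope ring_scope.

(* Time-homogeneous Markov chains on a finite state space, realized on an
   arbitrary probability space. *)
Section MarkovChain.
Context (d : measure_display) (Omega : measurableType d) (R : realType).
Context (P : probability Omega R) (S : finType).

Definition cond_prob (A H : set Omega) : R := fine (P (A `&` H)) / fine (P H).

Definition history (X : nat -> Omega -> S) (x : nat -> S) (t : nat) :
  set Omega := [set w | forall i, (i <= t)%N -> X i w = x i].

(* Since S is finite, measurability of X t for the discrete sigma-algebra on S
   amounts to measurability of the fibers. *)
Record markov_chain (Q : S -> S -> R) (s0 : S) (X : nat -> Omega -> S) :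
    Prop := MarkovChain {
  chain_measurable : forall t s, measurable (X t @^-1` [set s]);
  chain_start : P (X 0%N @^-1` [set s0]) = 1%E;
  chain_step : forall (t : nat) (x : nat -> S) (y : S),
    (0 < P (history X x t))%E ->
    cond_prob (X t.+1 @^-1` [set y]) (history X x t) = Q (x t) y }.

(* The infimum over the empty set is +oo, so this is +oo on the trajectories
   that never meet A. *)
Definition hitting_time (A : {pred S}) (X : nat -> Omega -> S) (w : Omega) :
  \bar R := ereal_inf [set (t%:R)%:E | t in [set t : nat | X t w \in A]].

(* The library's 'E_P[_] is restricted to real-valued functions, whereas a
   hitting time may be infinite. *)
Definition expected_hitting_time (A : {pred S}) (X : nat -> Omega -> S) :
  \bar R := \int[P]_w hitting_time A X w.

End MarkovChain.

(* With P_k in danger of being eliminated by P_{k+1}: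
   B1: P_k takes LS, then P_{k+1} takes LS;
   B2: P_k takes SS, then P_{k+1} takes SS;
   B3: P_{k+1} takes SS, then P_k takes SS;
   B4: P_k takes SS, then P_{k+1} takes LS;
   B5: P_{k+1} takes LS, then P_k takes SS. *)
Variant block := B1 | B2 | B3 | B4 | B5.

Definition ord_of_block (b : block) : 'I_5 :=
  match b with
  | B1 => inord 0 | B2 => inord 1 | B3 => inord 2 | B4 => inord 3
  | B5 => inord 4
  end.

Definition block_of_ord (i : 'I_5) : block :=
  nth B1 [:: B1; B2; B3; B4; B5] i.

Lemma ord_of_blockK : cancel ord_of_block block_of_ord.
Proof. by case; rewrite /block_of_ord /= inordK. Qed.

HB.instance Definition _ := Equality.copy block (can_type ord_of_blockK).
HB.instance Definition _ := Choice.copy block (can_type ord_of_blockK).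
HB.instance Definition _ := Countable.copy block (can_type ord_of_blockK).
HB.instance Definition _ := Finite.copy block (can_type ord_of_blockK).

(* inl (b, k) is the transient state (b, k) and inr k the absorbing state in
   which P_k is eliminated. The type 'Z_n is the integers modulo n only when
   1 < n. *)
Definition knockout_state (n : nat) : finType := (block * 'Z_n + 'Z_n)%type.

Section Knockout.
Context (R : realType) (n : nat) (p q : R).

(* The possible moves from a state, with their probabilities. *)
Definition knockout_moves (x : knockout_state n) :
    seq (knockout_state n * R) :=
  match x with
  | inl (B1, k) => [:: (inl (B1, k + 2), p ^+ 2);
                       (inl (B2, k), (1 - p) ^+ 2);
                       (inl (B5, k + 1), p * (1 - p));
                       (inr k, (1 - p) * p)]
  | inl (B2, k) => [:: (inl (B1, k + 2), q ^+ 2);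
                       (inl (B2, k), (1 - q) ^+ 2);
                       (inl (B5, k + 1), q * (1 - q));
                       (inr k, (1 - q) * q)]
  | inl (B3, k) => [:: (inl (B3, k), (1 - q) ^+ 2);
                       (inl (B4, k + 1), (1 - q) * q);
                       (inr k, q)]
  | inl (B4, k) => [:: (inl (B1, k + 2), q * p);
                       (inl (B2, k), (1 - q) * (1 - p));
                       (inl (B5, k + 1), q * (1 - p));
                       (inr k, (1 - q) * p)]
  | inl (B5, k) => [:: (inl (B3, k), (1 - p) * (1 - q));
                       (inl (B4, k + 1), (1 - p) * q);
                       (inr k, p)]
  | inr k => [:: (inr k, 1)]
  end.

Definition knockout_trans (x y : knockout_state n) : R :=
  \sum_(m <- knockout_moves x | m.1 == y) m.2.

End Knockout.

Definition knockout_start (n : nat) : knockout_state n := inl (B1, 1).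

Definition eliminated (n : nat) : {pred knockout_state n} :=
  fun x => if x is inr _ then true else false.

(* Main.v *)
Require Import Defs.
From mathcomp Require Import all_boot all_order all_algebra.
From mathcomp Require Import all_classical all_reals all_analysis.
From mathcomp Require Import measurable_realfun.
From mathcomp Require Import ring lra.

Import Order.TTheory GRing.Theory Num.Theory.
Import numFieldNormedType.Exports.
Local Open Scope classical_set_scope.
Local Open Scope ring_scope.

(** First-step analysis.  Let [e s] be a solution of the equations
    [e s = 0] on the target set [A] and [e s = 1 + \sum_y Q s y * e y] off it:
    one step is spent, then the chain starts afresh from its new state.  A
    solution that is nonnegative is automatically the expected hitting time.
    Indeed let [T] be the hitting time and let [V_t] be the expectation of
    [e (X t)] restricted to the event [T > t].  The equations and the Markov
    property give [V_{t+1} = V_t - P(T > t)], so that the partial sums of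
    [\sum_t P(T > t)] are [e s0 - V_N].  As [V_N >= 0] these are bounded, the
    series converges, its general term tends to [0], and then so does [V_N],
    which is at most [P(T > N)] times the sum of the values of [e].  Since [T]
    is the number of [t] with [T > t], the expectation of [T] is [e s0]
    ([expected_hitting_time_first_step]).  Almost sure absorption is thus a
    consequence of the existence of [e].

    Nonnegativity of [e] comes for free as well, by a minimum principle
    ([first_step_ge0]).

    In the game of Knockout the index [k] of the endangered player only labels
    the state: the transition probabilities between blocks do not depend on it.
    So [e] may be looked for as a function of the block alone, which leaves
    five linear equations in five unknowns, independent of [n].  Eliminating
    blocks 2 and 3, then solving for blocks 4 and 5 in terms of block 1, gives
    the closed forms below; that they satisfy the equations is a field identity
    ([mean_steps_first_step]), whose denominators do not vanish because
    [p - q + 1 = 0] would force [(p, q) = (0, 1)]. *)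

Set Implicit Arguments.
Unset Strict Implicit.

(** * Hitting times as sums of survival probabilities *)

Section HittingTime.
Context (d : measure_display) (Omega : measurableType d) (R : realType).
Context (P : probability Omega R) (S : finType).
Implicit Types (A : {pred S}) (X : nat -> Omega -> S) (Q : S -> S -> R).

Definition survival A X (t : nat) : set Omega :=
  [set w | forall i, (i <= t)%N -> X i w \notin A].

Lemma prob_partition (I : finType) (Y : Omega -> I) (B : set Omega) :
  (forall i, measurable (Y @^-1` [set i])) -> measurable B ->
  fine (P B) = \sum_i fine (P (B `&` Y @^-1` [set i])).
Proof.
move=> mY mB; apply: EFin_inj; rewrite -sumEFin fineK ?fin_num_measure//.
have mF i : measurable (B `&` Y @^-1` [set i]) by exact: measurableI.
under eq_bigr do rewrite fineK ?fin_num_measure//.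
have BE : B = \bigcup_(i in [set` index_enum I]) (B `&` Y @^-1` [set i]).
  apply/seteqP; split=> [w Bw|w [i _ []//]].
  by exists (Y w) => //=; exact: mem_index_enum.
rewrite [in LHS]BE measure_fin_bigcup//.
- by rewrite -fsbig_seq ?index_enum_uniq.
- by move=> i j _ _ [w [[_ <-] [_ <-]]].
Qed.

(** A hitting time counts the times at which the chain has not yet hit [A];
    this also holds, with both sides infinite, on trajectories that never do. *)
Lemma hitting_time_series A X w :
  hitting_time R A X w = (\sum_(t <oo) (\1_(survival A X t) w)%:E)%E.
Proof.
have ge0 t : (0 <= (\1_(survival A X t) w : R)%:E)%E by rewrite lee_fin.
have [[t0 At0]|noA] := pselect (exists t, X t w \in A); last first.
  have sE t : \1_(survival A X t) w = 1 :> R.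
    rewrite indicE mem_set// => i _; apply/negP => Xi; apply: noA; by exists i.
  rewrite /hitting_time (_ : [set _ | _ in _] = set0); last first.
    by apply/seteqP; split=> // x [t At _]; apply: noA; exists t.
  rewrite ereal_inf0; apply/esym/eqyP => r _.
  apply: le_trans (nneseries_lim_ge (Num.truncn r).+1 _) => //.
  under eq_bigr do rewrite sE.
  rewrite sumEFin lee_fin sumr_const_nat subn0.
  exact/ltW/truncnS_gt.
have [m Am mmin] :=
  ex_minnP (ex_intro (fun t => is_true (X t w \in A)) t0 At0).
have sE t : \1_(survival A X t) w = (t < m)%:R :> R.
  rewrite indicE; congr (_%:R); congr nat_of_bool; apply/idP/idP.
    by rewrite inE => st; rewrite ltnNge; apply/negP => /st; rewrite Am.
  move=> tm; rewrite inE => i it; apply/negP => /mmin.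
  by rewrite leqNgt (leq_ltn_trans it tm).
rewrite (_ : hitting_time R A X w = (m%:R)%:E); last first.
  apply/eqP; rewrite eq_le; apply/andP; split.
    by apply: ereal_inf_lbound; exists m.
  by apply/ereal_infP => _ [t /mmin mt <-]; rewrite lee_fin ler_nat.
rewrite (nneseries_split _ m)// add0n eseries0 ?adde0; last first.
  by move=> i mi _; rewrite sE ltnNge mi.
rewrite sumEFin; congr EFin; rewrite big_nat.
under eq_bigr => i /andP[_ im] do rewrite sE im.
by rewrite -big_nat sumr_const_nat subn0.
Qed.

(** * First-step analysis *)

Section Chain.
Context (A : {pred S}) (Q : S -> S -> R) (s0 : S) (X : nat -> Omega -> S).
Hypothesis chainX : markov_chain P Q s0 X.

Let mX t s : measurable (X t @^-1` [set s]) := chain_measurable chainX t s.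

Let mXpred t (B : {pred S}) : measurable [set w | X t w \in B].
Proof.
rewrite (_ : [set _ | _] = \bigcup_(s in [set s | s \in B]) X t @^-1` [set s]).
  apply: fin_bigcup_measurable => //; exact: finite_finset.
by apply/seteqP; split=> [w Bw|w [s Bs /= ->]//]; exists (X t w).
Qed.

Lemma measurable_survival t : measurable (survival A X t).
Proof.
rewrite (_ : survival A X t =
    \bigcap_(i in [set i | (i <= t)%N]) [set w | X i w \in [predC A]]).
  by apply: bigcap_measurable => [|i _]; [exists 0%N | exact: mXpred].
by apply/seteqP; split=> w h i it; exact: h.
Qed.

Let measurable_history x t : measurable (history X x t).
Proof.
rewrite (_ : history X x t =
    \bigcap_(i in [set i | (i <= t)%N]) (X i @^-1` [set x i])) //.
by apply: bigcap_measurable => [|i _]; [exists 0%N | exact: mX].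
Qed.

Lemma expected_hitting_time_series :
  expected_hitting_time P A X = (\sum_(t <oo) P (survival A X t))%E.
Proof.
rewrite /expected_hitting_time.
under eq_integral do rewrite hitting_time_series.
rewrite integral_nneseries//.
- apply: eq_eseriesr => t _.
  by rewrite integral_indic ?setIT//; exact: measurable_survival.
- by move=> t; apply/measurable_EFinP; apply: measurable_indic;
    exact: measurable_survival.
Qed.

(** The Markov property in product form, which holds for null histories too. *)
Lemma prob_history_step x t y :
  fine (P (history X x t `&` X t.+1 @^-1` [set y])) =
  fine (P (history X x t)) * Q (x t) y.
Proof.
have [H0|H0] := eqVneq (P (history X x t)) 0%E.
  rewrite H0 mul0r (_ : P _ = 0%E)//; apply/eqP.
  rewrite eq_le measure_ge0 andbT.
  rewrite -H0; apply: le_measure; rewrite ?inE; [exact: measurableI|by []|].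
  exact: subIsetl.
have Hgt : (0 < P (history X x t))%E by rewrite lt0e H0 measure_ge0.
rewrite -(chain_step chainX y Hgt) /cond_prob setIC mulrC divfK//.
by rewrite fine_eq0// fin_num_measure.
Qed.

(** The law at time [t] of the chain killed when it hits [A]. *)
Definition survival_at t s : R :=
  fine (P (survival A X t `&` X t @^-1` [set s])).

(** The Markov property conditions on complete histories, so the event of
    surviving and being in [s] at time [t] is cut into histories: each of them
    either lies inside this event or is disjoint from it. *)
Lemma prob_survival_step t s y :
  fine (P (survival A X t `&` X t @^-1` [set s] `&` X t.+1 @^-1` [set y])) =
  survival_at t s * Q s y.
Proof.
pose Y w : {ffun 'I_t.+1 -> S} := [ffun i => X (val i) w].
have YE f : Y @^-1` [set f] = history X (fun i => f (inord i)) t.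
  apply/seteqP; split=> w /= h.
    by move=> i it; rewrite -h ffunE /= inordK.
  apply/ffunP => i; rewrite ffunE h; first by rewrite inord_val.
  exact: ltn_ord i.
have mY f : measurable (Y @^-1` [set f]) by rewrite YE.
have mSX : measurable (survival A X t `&` X t @^-1` [set s]).
  by apply: measurableI; [exact: measurable_survival|exact: mX].
rewrite /survival_at (prob_partition mY mSX).
rewrite (prob_partition mY (measurableI _ _ mSX (mX t.+1 y))).
rewrite mulr_suml; apply: eq_bigr => f _; rewrite YE.
set H := history _ _ _.
have [[w [[Sw Xw] Hw]]|empty] :=
  pselect (exists w, (survival A X t `&` X t @^-1` [set s] `&` H) w).
  have sub : H `<=` survival A X t `&` X t @^-1` [set s].
    move=> v Hv; split=> [i it|/=]; first by rewrite Hv// -Hw//; exact: Sw.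
    by rewrite Hv// -Hw.
  rewrite [_ `&` H in LHS]setIAC (setIidr sub) prob_history_step -Hw//.
  by rewrite Xw.
rewrite (_ : _ `&` H = set0); last first.
  by apply/seteqP; split=> // v hv; apply: empty; exists v;
    case: hv => -[].
rewrite (_ : _ `&` H = set0) ?measure0 ?mul0r//.
by apply/seteqP; split=> // v hv; apply: empty; exists v.
Qed.

Lemma prob_survival t : fine (P (survival A X t)) = \sum_s survival_at t s.
Proof. exact: prob_partition (mX t) (measurable_survival t). Qed.

Lemma survival_at_ge0 t s : 0 <= survival_at t s.
Proof. by rewrite fine_ge0. Qed.

Lemma survival_at_absorbed t s : s \in A -> survival_at t s = 0.
Proof.
move=> As; rewrite /survival_at (_ : _ `&` _ = set0) ?measure0//.
apply/seteqP; split=> // w [/(_ t (leqnn t))] /[swap] /= ->.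
by rewrite As.
Qed.

Lemma survival_at0 s : s \notin A -> survival_at 0 s = (s == s0)%:R.
Proof.
move=> As; rewrite /survival_at.
have -> : survival A X 0 `&` X 0%N @^-1` [set s] = X 0%N @^-1` [set s].
  by apply/setIidr => w /= Xw i; rewrite leqn0 => /eqP ->; rewrite Xw.
have [->|ss0] := eqVneq s s0; first by rewrite (chain_start chainX).
rewrite (_ : P _ = 0%E)//; apply/eqP; rewrite eq_le measure_ge0 andbT.
have <- : P (~` (X 0%N @^-1` [set s0])) = 0%E.
  by rewrite probability_setC// (chain_start chainX) subee.
apply: le_measure; rewrite ?inE; [exact: mX|by apply: measurableC; exact: mX|].
by move=> w /= -> /eqP; rewrite (negbTE ss0).
Qed.

Lemma survival_atS t y : y \notin A ->
  survival_at t.+1 y = \sum_s survival_at t s * Q s y.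
Proof.
move=> Ay; rewrite /survival_at.
have -> : survival A X t.+1 `&` X t.+1 @^-1` [set y] =
          survival A X t `&` X t.+1 @^-1` [set y].
  apply/seteqP; split=> w [Sw Xw]; split=> // i it; first exact/Sw/ltnW.
  by move: it; rewrite leq_eqVlt => /predU1P[->|/Sw//]; rewrite Xw.
rewrite (prob_partition (mX t)); last first.
  by apply: measurableI; [exact: measurable_survival|exact: mX].
by apply: eq_bigr => s _; rewrite -prob_survival_step setIAC.
Qed.

Context (e : S -> R).
Hypothesis e_ge0 : forall s, 0 <= e s.
Hypothesis e_hit : forall s, s \in A -> e s = 0.
Hypothesis e_step : forall s, s \notin A -> e s = 1 + \sum_y Q s y * e y.

(** The expectation of [e (X t)] on the event that [A] is not hit by time [t];
    once [e] is known to be the expected hitting time, it is the expected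
    number of steps still to come after time [t]. *)
Let remaining t := \sum_s survival_at t s * e s.

Let remaining0 : remaining 0 = e s0.
Proof.
rewrite /remaining (bigD1 s0)//= big1 ?addr0 => [|s ss0].
  have [As|As] := boolP (s0 \in A); first by rewrite e_hit// mulr0.
  by rewrite survival_at0// eqxx mul1r.
have [As|As] := boolP (s \in A); first by rewrite e_hit// mulr0.
by rewrite survival_at0// (negbTE ss0) mul0r.
Qed.

(** The first-step equation trades one step for the passage from [t] to [t.+1];
    [e] vanishing on [A] lets the killed chain be summed over all states. *)
Let remainingS t :
  remaining t.+1 = remaining t - fine (P (survival A X t)).
Proof.
rewrite /remaining prob_survival -sumrB.
transitivity (\sum_y \sum_s survival_at t s * (Q s y * e y)).
  apply: eq_bigr => y _; have [Ay|Ay] := boolP (y \in A).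
    by rewrite e_hit// mulr0 big1// => s _; rewrite !mulr0.
  by rewrite survival_atS// mulr_suml; apply: eq_bigr => s _; rewrite mulrA.
rewrite exchange_big; apply: eq_bigr => s _; rewrite -mulr_sumr.
have [As|As] := boolP (s \in A).
  by rewrite survival_at_absorbed// !mul0r subrr.
by rewrite e_step// mulrDr mulr1 addrAC subrr add0r.
Qed.

(** Telescoping [remainingS] bounds the series of survival probabilities, so its
    terms tend to [0]; that in turn makes [remaining] vanish in the limit and
    identifies the sum. *)
Lemma expected_hitting_time_first_step :
  expected_hitting_time P A X = (e s0)%:E.
Proof.
pose u t := fine (P (survival A X t)).
have u_ge0 t : 0 <= u t by rewrite fine_ge0.
have remaining_ge0 t : 0 <= remaining t.
  by apply: sumr_ge0 => s _; rewrite mulr_ge0// survival_at_ge0.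
have series_u N : series u N = e s0 - remaining N.
  elim: N => [|N IHN]; first by rewrite /series/= big_geq// remaining0 subrr.
  rewrite /series/= big_nat_recr//= remainingS.
  by move: IHN; rewrite /series/= => ->; rewrite opprB addrA addrAC.
have cvg_u : cvgn (series u).
  apply: nondecreasing_is_cvgn.
    by apply/nondecreasing_seqP => N; rewrite /series/= big_nat_recr//= lerDl.
  by exists (e s0) => _ [N _ <-]; rewrite series_u gerBl.
have cvg_remaining : remaining @ \oo --> 0.
  apply: (@squeeze_cvgr _ _ _ _ (cst 0) (fun N => u N * \sum_s e s)).
  - near=> N; rewrite remaining_ge0/=.
    rewrite /u prob_survival mulr_suml ler_sum// => s _.
    rewrite ler_wpM2l ?survival_at_ge0//.
    by rewrite (bigD1 s)//= lerDl sumr_ge0.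
  - exact: cvg_cst.
  - rewrite -[X in _ --> X](mul0r (\sum_s e s)).
    by apply: cvgM; [exact: cvg_series_cvg_0|exact: cvg_cst].
have cvg_series_u : series u @ \oo --> e s0.
  rewrite (_ : series u = fun N => e s0 - remaining N); last exact/funext.
  by rewrite -[X in _ --> X]subr0; apply: cvgB => //; exact: cvg_cst.
rewrite expected_hitting_time_series; apply/cvg_lim => //.
rewrite (_ : (fun N => _) = EFin \o series u);
  first exact: cvg_comp cvg_series_u _.
apply/funext => N; rewrite /series/= -sumEFin; apply: eq_bigr => t _.
by rewrite fineK// fin_num_measure//; exact: measurable_survival.
Unshelve. all: by end_near. Qed.

End Chain.
End HittingTime.

(** Minimum principle: if the minimum [e m] were negative, then [m] would not be
    in [A], and averaging [e] with weights of sum at most [1] would give at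
    least [e m], so that [e m >= 1 + e m]. *)
Lemma first_step_ge0 (R : realFieldType) (S : finType) (A : {pred S})
    (Q : S -> S -> R) (e : S -> R) :
  (forall s y, 0 <= Q s y) -> (forall s, \sum_y Q s y <= 1) ->
  (forall s, s \in A -> e s = 0) ->
  (forall s, s \notin A -> e s = 1 + \sum_y Q s y * e y) ->
  forall s, 0 <= e s.
Proof.
move=> Q_ge0 Q_sum e_hit e_step s.
case: (Order.TotalTheory.arg_minP e (isT : xpredT s)) => m _ e_min.
apply: le_trans (e_min s isT); rewrite leNgt; apply/negP => em_lt0.
have Am : m \notin A by apply: contraL em_lt0 => /e_hit ->; rewrite ltxx.
suff : e m < e m by rewrite ltxx.
rewrite {2}e_step// -ltrBlDl.
apply: (@lt_le_trans _ _ ((\sum_y Q m y) * e m)); last first.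
  by rewrite mulr_suml ler_sum// => y _; rewrite ler_wpM2l// e_min.
apply: (@lt_le_trans _ _ (e m)); first by rewrite ltrBlDl ltrDr.
by rewrite -[leLHS]mul1r ler_wnM2r// ltW.
Qed.

(** * The equations for Knockout *)

Section Knockout.
Context (R : realType) (n : nat) (p q : R).

Local Notation Q := (@knockout_trans R n p q).

Definition mean_steps1 : R :=
  (- (p + q - 3) * (p ^+ 2 - p * q - 2 * p + 2 * q + 1)) /
  (q * (p - 3) * (p - 1) * (p - q + 1)).

(** The first-step equations for blocks 2 and 3 express their values through
    blocks 1, 4 and 5, because [1 - (1 - q) ^+ 2 = q * (2 - q)].  Substituting
    these in the equations for blocks 4 and 5 leaves, with
    [k := (1 - p) * (1 - q) / (q * (2 - q))] and [r := (1 - p) / (2 - q)], the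
    system [e5 = 1 + k + r * e4],
    [e4 = 1 + k + q * (p - q + 1) / (2 - q) * e1 + r * e5]; the formula for [e4]
    is its solution, where [1 - r = (p - q + 1) / (2 - q)] and
    [1 + r = (3 - p - q) / (2 - q)]. *)
Definition mean_steps4 : R :=
  (q * (2 - q) + (1 - p) * (1 - q)) / (q * (p - q + 1)) +
  q * (2 - q) / (3 - p - q) * mean_steps1.

Definition mean_steps5 : R :=
  1 + (1 - p) * (1 - q) / (q * (2 - q)) + (1 - p) / (2 - q) * mean_steps4.

Definition mean_steps (x : knockout_state n) : R :=
  match x with
  | inl (B1, _) => mean_steps1
  | inl (B2, _) =>
      (1 + q ^+ 2 * mean_steps1 + q * (1 - q) * mean_steps5) / (q * (2 - q))
  | inl (B3, _) => (1 + (1 - q) * q * mean_steps4) / (q * (2 - q))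
  | inl (B4, _) => mean_steps4
  | inl (B5, _) => mean_steps5
  | inr _ => 0
  end.

(** Several moves may lead to the same state when [n] is small; the transition
    probability adds their weights, so sums over states are sums over moves. *)
Lemma sum_knockout_trans (f : knockout_state n -> R) x :
  \sum_y Q x y * f y =
  \sum_(m <- @knockout_moves R n p q x) m.2 * f m.1.
Proof.
rewrite /knockout_trans; under eq_bigr do rewrite big_distrl/= big_mkcond/=.
rewrite exchange_big/=; apply: eq_bigr => m _.
by rewrite -big_mkcond/= (big_pred1 m.1).
Qed.

Lemma knockout_trans_ge0 x y : 0 <= p < 1 -> 0 < q <= 1 ->
  0 <= Q x y.
Proof.
move=> /andP[p0 p1] /andP[q0 q1].
have [p1' q1'] : 0 <= 1 - p /\ 0 <= 1 - q by rewrite !subr_ge0 q1 (ltW p1).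
have q0' := ltW q0.
rewrite /knockout_trans big_seq_cond sumr_ge0// => m /andP[+ _].
move: x => [[[] k]|k] /=; rewrite !inE;
  repeat (case/orP; last try move=> /eqP-> /=); try move=> /eqP-> /=;
  by rewrite ?mulr_ge0// ?exprn_ge0.
Qed.

Lemma sum_knockout_trans_eq1 x : \sum_y Q x y = 1.
Proof.
under eq_bigr do rewrite -[Q _ _]mulr1.
rewrite (sum_knockout_trans (fun=> 1)).
by case: x => [[[] k]|k] /=; rewrite !big_cons big_nil/=; ring.
Qed.

Lemma mean_steps_first_step x : 0 <= p < 1 -> 0 < q <= 1 -> (p, q) <> (0, 1) ->
  x \notin @eliminated n ->
  mean_steps x = 1 + \sum_y Q x y * mean_steps y.
Proof.
move=> /andP[p0 p1] /andP[q0 q1] pq01.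
have d1 : q != 0 by rewrite gt_eqF.
have d2 : p - 3 != 0 by rewrite lt_eqF//; lra.
have d3 : p - 1 != 0 by rewrite lt_eqF//; lra.
have d4 : p - q + 1 != 0.
  by apply/eqP => d0; apply: pq01; congr pair; lra.
have d5 : 2 - q != 0 by rewrite gt_eqF//; lra.
have d6 : 3 - p - q != 0 by rewrite gt_eqF//; lra.
rewrite sum_knockout_trans.
case: x => [[[] k]|//] _ /=; rewrite !big_cons big_nil/=
  /mean_steps5 /mean_steps4 /mean_steps1; field;
  by rewrite ?d1 ?d2 ?d3 ?d4 ?d5 ?d6.
Qed.

End Knockout.

Theorem theorem5p1 (R : realType) (n : nat) (p q : R)
    (d : measure_display) (Omega : measurableType d)
    (P : probability Omega R) (X : nat -> Omega -> knockout_state n) :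
  (2 <= n)%N ->
  0 <= p < 1 -> 0 < q <= 1 -> (p, q) <> (0, 1) ->
  markov_chain P (knockout_trans p q) (knockout_start n) X ->
  expected_hitting_time P (@eliminated n) X =
    ((- (p + q - 3) * (p ^+ 2 - p * q - 2 * p + 2 * q + 1)) /
     (q * (p - 3) * (p - 1) * (p - q + 1)))%:E.
Proof.
move=> _ p01 q01 pq01 chainX.
have mean_hit s : s \in @eliminated n -> mean_steps p q s = 0.
  by case: s => [[[]]|].
have mean_step s := @mean_steps_first_step R n p q s p01 q01 pq01.
apply: (expected_hitting_time_first_step chainX
  (e := @mean_steps R n p q)) => //.
apply: (first_step_ge0 (A := @eliminated n)
  (Q := @knockout_trans R n p q)) => //.
- by move=> s y; exact: knockout_trans_ge0.
- by move=> s; rewrite sum_knockout_trans_eq1.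
Qed.
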